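(* Let $R$ and $S$ be finite unital rings, where $S$ is semisimple and has no nonzero homomorphic image isomorphic to a field. If $\varTheta(R)\cong\varTheta(S)$ as directed graphs, then $R\cong S$ as rings.
   Context: For a finite unital ring $R$, define $a\sim b$ if and only if $a=bu=vb$ for some units $u,v\in R$; this is an equivalence relation, and $[a]$ denotes the class of $a$. $\varTheta(R)$ is the directed graph whose vertices are the classes $[a]$, $a\in R$, with a directed edge $[x]\to[y]$ ($[x]$, $[y]$ not necessarily distinct) if and only if $xy=0$ (this is well defined). *)

(* Defs.v *)
From mathcomp Require Import all_boot all_algebra.

Set Implicit Arguments.
Unset Strict Implicit.
Unset Printing Implicit Defensive.

Import GRing.Theory.
Local Open Scope ring_scope.

(* Loops are allowed. *)
Record digraph := Digraph { vertex : finType; edge : rel vertex }.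

Definition digraph_isomorphic (G H : digraph) : Prop :=
  exists f : vertex G -> vertex H,
    bijective f /\ forall x y, edge (f x) (f y) = edge x y.

(* [finPzRingType] is the type of all finite unital rings, the zero ring
   included; [GRing.unit] is not available there, whence the explicit
   two-sided invertibility below. *)
Section CompressedZeroDivisorGraph.
Variable R : finPzRingType.
Implicit Types a b x y u v : R.

Definition is_unit u : bool := [exists v, (u * v == 1) && (v * u == 1)].

Definition sim a b : bool :=
  [exists u, exists v,
    [&& is_unit u, is_unit v, a == b * u & a == v * b]].

Definition sim_classes : {set {set R}} :=
  equivalence_partition sim [set: R].

Definition Theta_vertex : finType := {A : {set R} | A \in sim_classes}.

(* Independent of the chosen representatives, see [Theta_edgeE]. *)
Definition Theta_edge : rel Theta_vertex :=
  fun A B => [exists x in val A, exists y in val B, x * y == 0].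

Definition Theta : digraph := Digraph Theta_edge.

Lemma is_unit1 : is_unit 1.
Proof. by apply/existsP; exists 1; rewrite mulr1 eqxx. Qed.

Lemma is_unitM u v : is_unit u -> is_unit v -> is_unit (u * v).
Proof.
move=> /existsP[u' /andP[/eqP uu' /eqP u'u]].
move=> /existsP[v' /andP[/eqP vv' /eqP v'v]].
apply/existsP; exists (v' * u'); apply/andP; split; apply/eqP.
  by rewrite mulrA -(mulrA u) vv' mulr1.
by rewrite mulrA -(mulrA v') u'u mulr1.
Qed.

Lemma sim_refl : reflexive sim.
Proof.
move=> a; apply/existsP; exists 1; apply/existsP; exists 1.
by rewrite is_unit1 mulr1 mul1r eqxx.
Qed.

Lemma sim_sym_imp a b : sim a b -> sim b a.
Proof.
move=> /existsP[u /existsP[v /and4P[Uu Uv /eqP abu /eqP avb]]].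
have /existsP[u' /andP[/eqP uu' /eqP u'u]] := Uu.
have /existsP[v' /andP[/eqP vv' /eqP v'v]] := Uv.
apply/existsP; exists u'; apply/existsP; exists v'; apply/and4P; split.
- by apply/existsP; exists u; rewrite uu' u'u eqxx.
- by apply/existsP; exists v; rewrite vv' v'v eqxx.
- by rewrite abu -mulrA uu' mulr1.
- by rewrite avb mulrA v'v mul1r.
Qed.

Lemma sim_sym : symmetric sim.
Proof. by move=> a b; apply/idP/idP; apply: sim_sym_imp. Qed.

Lemma sim_trans : transitive sim.
Proof.
move=> b a c.
move=> /existsP[u /existsP[v /and4P[Uu Uv /eqP abu /eqP avb]]].
move=> /existsP[w /existsP[z /and4P[Uw Uz /eqP bcw /eqP bzc]]].
apply/existsP; exists (w * u); apply/existsP; exists (v * z).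
rewrite !is_unitM //= mulrA -bcw -abu eqxx /=.
by rewrite -mulrA -bzc -avb eqxx.
Qed.

Lemma sim_equivalence : {in [set: R] & &, equivalence_rel sim}.
Proof.
move=> a b c _ _ _; split; first exact: sim_refl.
by move=> ab; apply/idP/idP; apply: sim_trans => //; rewrite sim_sym.
Qed.

Lemma sim_class_subproof x : [set y in [set: R] | sim x y] \in sim_classes.
Proof. by apply: imset_f; rewrite inE. Qed.

Definition sim_class x : Theta_vertex :=
  exist (fun A => A \in sim_classes) _ (sim_class_subproof x).

Lemma sim_class_surj (A : Theta_vertex) : exists x, A = sim_class x.
Proof.
case: A => A AP; have /imsetP[x _ Ax] := AP.
by exists x; apply: val_inj.
Qed.

Lemma sim_class_eq x y : (sim_class x == sim_class y) = sim x y.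
Proof.
rewrite -val_eqE /=; apply/eqP/idP => [/setP/(_ y)|xy].
  by rewrite !inE sim_refl.
apply/setP=> z; rewrite !inE /=.
by have [_ ->] := sim_equivalence (in_setT x) (in_setT y) (in_setT z).
Qed.

Lemma Theta_edgeE x y : Theta_edge (sim_class x) (sim_class y) = (x * y == 0).
Proof.
apply/existsP/idP => [[x1 /andP[]]|xy0]; last first.
  exists x; rewrite !inE sim_refl /=; apply/existsP.
  by exists y; rewrite !inE sim_refl.
rewrite !inE /= => /existsP[_ /existsP[v /and4P[_ _ _ /eqP xE]]].
case/existsP=> y1 /andP[]; rewrite !inE /=.
move=> /existsP[u /existsP[_ /and4P[_ _ /eqP yE _]]] /eqP xy0.
by rewrite xE yE mulrA -(mulrA v) xy0 mulr0 mul0r.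
Qed.

End CompressedZeroDivisorGraph.

Section Semisimple.
Variable R : finPzRingType.
Implicit Types I J : {set R}.

(* The left ideals are the submodules of the left regular module [R^o]. *)
Definition left_ideal I : Prop := submod_closed (I : {set R^o}).

Definition simple_left_ideal I : Prop :=
  [/\ left_ideal I, I <> [set 0] &
      forall J, left_ideal J -> J \subset I -> J = [set 0] \/ J = I].

(* The left regular module is an (internal) direct sum of simple submodules;
   finitely many summands suffice because [R] is finite. *)
Definition semisimple_ring : Prop :=
  exists (n : nat) (I : 'I_n -> {set R}),
    (forall i, simple_left_ideal (I i)) /\
    forall x : R, exists! f : {ffun 'I_n -> R},
      (forall i, f i \in I i) /\ x = \sum_(i < n) f i.

End Semisimple.

(* Up to isomorphism, the homomorphic images of [R] are the codomains of the
   surjective morphisms from [R]; a [fieldType] is commutative and nonzero. *)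
Definition has_field_image (R : pzRingType) : Prop :=
  exists (F : fieldType) (f : {rmorphism R -> F}),
    forall y : F, exists x : R, f x = y.

Definition ring_isomorphic (R S : pzRingType) : Prop :=
  exists f : {rmorphism R -> S}, bijective f.

(* Main.v *)
Require Import Defs.
From HB Require Import structures.
From mathcomp Require Import all_boot all_algebra all_solvable all_field.

(** An isomorphism of the graphs preserves the annihilators of elements. A pair of
    complementary idempotents (e, 1 - e) is recognised by ef = fe = 0 together with the
    absence of common annihilators, so the idempotents of R and S correspond, and so do
    the relations ea = a and ae = a. As S is von Neumann regular, every class of S has the
    annihilators of idempotents bc and cb, and going back to R this makes R von Neumann
    regular as well. A maximal orthogonal system of idempotents e_i of R then consists of
    primitive idempotents with sum 1 and corresponds to such a system s_i of S, with
    e_i R e_j <> 0 if and only if s_i S s_j <> 0. Since S has no field image, for each i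
    there is j <> i with e_i R e_j <> 0; counting the idempotents e_i + y with
    y in e_i R e_j shows that the corners e_i R e_i and s_i S s_i have the same
    cardinality, hence by Wedderburn's little theorem are isomorphic fields. Matrix units
    assemble these field isomorphisms into an isomorphism from R to S. *)

Set Implicit Arguments.
Unset Strict Implicit.
Unset Printing Implicit Defensive.

Import GRing.Theory.
Local Open Scope ring_scope.

(** * Idempotents of a finite ring *)

Section FiniteRing.
Variable R : finPzRingType.
Implicit Types a b e t w x : R.

Definition idem e := e * e = e.

Definition regular := forall a, exists x, a * x * a = a.

Definition primitive e :=
  [/\ idem e, e != 0 & forall f, idem f -> e * f = f -> f * e = f ->
                         f = 0 \/ f = e].

Lemma idemC e : idem e -> idem (1 - e).
Proof. by move=> ee; rewrite /idem mulrBl mul1r mulrBr mulr1 ee subrr subr0. Qed.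

Lemma idem_mulC e : idem e -> e * (1 - e) = 0.
Proof. by move=> ee; rewrite mulrBr mulr1 ee subrr. Qed.

Lemma idemC_mul e : idem e -> (1 - e) * e = 0.
Proof. by move=> ee; rewrite mulrBl mul1r ee subrr. Qed.

Lemma mulC_eq0 e x : (1 - e) * x = 0 <-> e * x = x.
Proof.
rewrite mulrBl mul1r; split=> [/eqP|->]; last exact: subrr.
by rewrite subr_eq0 => /eqP <-.
Qed.

Lemma mul_eq0C e x : x * (1 - e) = 0 <-> x * e = x.
Proof.
rewrite mulrBr mulr1; split=> [/eqP|->]; last exact: subrr.
by rewrite subr_eq0 => /eqP <-.
Qed.

(** Finiteness: left multiplication by [t] is injective, hence onto, so [t * w = 1] for some [w];
    then [t] kills [w * t - 1]. *)
Lemma lreg_inverse t :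
  (forall x, t * x = 0 -> x = 0) -> exists w, t * w = 1 /\ w * t = 1.
Proof.
move=> treg.
have tinj : injective ( *%R t).
  move=> x y txy; apply/eqP; rewrite -subr_eq0; apply/eqP/treg.
  by rewrite mulrBr txy subrr.
have /codomP[w w1] := injF_onto tinj 1.
exists w; split=> //; apply/eqP; rewrite -subr_eq0; apply/eqP/treg.
by rewrite mulrBr mulrA -w1 mul1r mulr1 subrr.
Qed.

Lemma is_unitP t : reflect (exists w, t * w = 1 /\ w * t = 1) (is_unit t).
Proof.
apply: (iffP existsP) => [[w /andP[/eqP tw /eqP wt]]|[w [tw wt]]]; exists w => //.
by rewrite tw wt !eqxx.
Qed.

Lemma simP a b :
  reflect (exists u v, [/\ is_unit u, is_unit v, a = b * u & a = v * b])
          (sim a b).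
Proof.
apply: (iffP existsP) => [[u /existsP[v /and4P[Uu Uv /eqP abu /eqP avb]]]|].
  by exists u, v; split.
move=> [u [v [Uu Uv abu avb]]]; exists u; apply/existsP; exists v.
by rewrite Uu Uv -avb -abu !eqxx.
Qed.

(** From [e = f * u] comes [f * e = e], and from [f = v * e] comes [f * e = f]. *)
Lemma sim_idem e f : idem e -> idem f -> sim e f -> e = f.
Proof.
move=> ee ff ef; have fe := sim_sym_imp ef.
have /simP[u [_ [_ _ efu _]]] := ef; have /simP[_ [v [_ _ _ fve]]] := fe.
by rewrite [RHS]fve -{2}ee mulrA -fve efu mulrA ff.
Qed.

Lemma sim_complementary_idem b c :
    b * c = 0 -> c * b = 0 -> (forall x, b * x = 0 -> c * x = 0 -> x = 0) ->
  exists g, [/\ idem g, sim b g & sim c (1 - g)].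
Proof.
(* t = b + c is a unit commuting with b and c, and g = t^-1 b. *)
move=> bc cb bc0.
have [x tx0|w [tw wt]] := @lreg_inverse (b + c).
  have bx0 : b * x = 0.
    apply: bc0; last by rewrite mulrA cb mul0r.
    have : b * ((b + c) * x) = 0 by rewrite tx0 mulr0.
    by rewrite mulrA mulrDr bc addr0 mulrA.
  by apply: bc0 => //; move: tx0; rewrite mulrDl bx0 add0r.
have Ut : is_unit (b + c) by apply/is_unitP; exists w.
have tb : (b + c) * b = b * (b + c) by rewrite mulrDl mulrDr bc cb.
have tc : (b + c) * c = c * (b + c) by rewrite mulrDl mulrDr bc cb.
have gE : 1 - w * b = w * c by rewrite -wt mulrDr addrAC subrr add0r.
have simw d : (b + c) * d = d * (b + c) -> sim d (w * d).
  move=> td; apply/simP; exists (b + c), (b + c).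
  by rewrite -mulrA -td !mulrA wt tw !mul1r.
exists (w * b); split; rewrite ?gE; [|exact: simw..].
apply/mul_eq0C; rewrite gE.
have wcomm d : (b + c) * d = d * (b + c) -> w * d = d * w.
  move=> td; rewrite -[in LHS](mulr1 d) -tw !mulrA -(mulrA w) -td.
  by rewrite mulrA wt mul1r.
have wwc : w * (w * c) = c * (w * w).
  by rewrite (wcomm c tc) mulrA (wcomm c tc) mulrA.
by rewrite (wcomm b tb) -mulrA wwc mulrA bc mul0r.
Qed.

End FiniteRing.

(** * Semisimple rings are von Neumann regular *)

Section Semisimple.
Variable R : finPzRingType.
Implicit Types I J K L : {set R}.

Definition lideal I :=
  [/\ 0 \in I, forall x y, x \in I -> y \in I -> x - y \in I &
      forall a x, x \in I -> a * x \in I].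

Lemma lidealP I : left_ideal I <-> lideal I.
Proof.
split=> [[I0 IZ]|[I0 IB IM]].
  have IM a x : x \in I -> a * x \in I.
    by move=> xI; have := IZ a x 0 xI I0; rewrite addr0.
  split=> // x y xI yI; have := IZ (-1) y x yI xI.
  by rewrite addrC scaleN1r.
split=> // a x y xI yI; rewrite -[a *: x]opprK addrC -[x]/(x : R).
by apply: (IB) => //; have := IB 0 _ I0 (IM a x xI); rewrite sub0r.
Qed.

Definition lsum I J := [set x | [exists a in I, exists b in J, x == a + b]].

Lemma lsumP I J x :
  reflect (exists a b, [/\ a \in I, b \in J & x = a + b]) (x \in lsum I J).
Proof.
rewrite inE; apply: (iffP existsP) => [[a /andP[aI /existsP[b /andP[bJ /eqP]]]]|].
  by exists a, b.
move=> [a [b [aI bJ ->]]]; exists a; rewrite aI; apply/existsP; exists b.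
by rewrite bJ eqxx.
Qed.

Lemma lideal_sum I J : lideal I -> lideal J -> lideal (lsum I J).
Proof.
move=> [I0 IB IM] [J0 JB JM]; split.
- by apply/lsumP; exists 0, 0; rewrite addr0.
- move=> _ _ /lsumP[a [b [aI bJ ->]]] /lsumP[c [d [cI dJ ->]]].
  apply/lsumP; exists (a - c), (b - d); split; [exact: IB|exact: JB|].
  by rewrite opprD addrACA.
- move=> x _ /lsumP[a [b [aI bJ ->]]]; apply/lsumP; exists (x * a), (x * b).
  by split; [exact: IM|exact: JM|rewrite mulrDr].
Qed.

Lemma lideal_capI I J : lideal I -> lideal J -> lideal (I :&: J).
Proof.
move=> [I0 IB IM] [J0 JB JM]; split; first by rewrite inE I0.
- move=> x y; rewrite !inE => /andP[xI xJ] /andP[yI yJ].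
  by rewrite IB ?JB.
- by move=> a x; rewrite !inE => /andP[xI xJ]; rewrite IM ?JM.
Qed.

Lemma lideal_principal b : lideal [set x * b | x in setT].
Proof.
split; first by apply/imsetP; exists 0; rewrite ?mul0r.
- move=> _ _ /imsetP[x _ ->] /imsetP[y _ ->]; apply/imsetP; exists (x - y) => //.
  by rewrite mulrBl.
- move=> a _ /imsetP[x _ ->]; apply/imsetP; exists (a * x) => //.
  by rewrite mulrA.
Qed.

(** Greedy choice: [K] absorbs the simple ideal of index [m] if this meets [L + K] in 0; otherwise,
    by simplicity, it already lies in [L + K]. If the [I i] span the ring, [m = n] yields a
    complement of [L]. *)
Lemma complement_upto n (I : 'I_n -> {set R}) L :
    (forall i, simple_left_ideal (I i)) -> lideal L ->
  forall m, exists K, [/\ lideal K, L :&: K = [set 0] &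
    forall i : 'I_n, (i < m)%N -> I i \subset lsum L K].
Proof.
move=> Isimple Lid; have [L0 LB _] := Lid; elim=> [|m [K [Kid LK0 subK]]].
  exists [set 0]; split=> //; last first.
    by apply/setP=> x; rewrite !inE andb_idl // => /eqP->.
  split=> [|x y|a x]; rewrite !inE // => /eqP->; last by rewrite mulr0.
  by move=> /eqP->; rewrite subrr.
have [K0 KB _] := Kid.
have [mn|] := ltnP m n; last first.
  move=> nm; exists K; split=> // i _; apply: subK.
  exact: leq_trans (ltn_ord i) nm.
have [/lidealP Jid J0 Jmin] := Isimple (Ordinal mn).
set J := I (Ordinal mn) in Jid J0 Jmin.
have caseI i : (i < m.+1)%N -> (i < m)%N \/ i = m.
  by rewrite ltnS leq_eqVlt => /orP[/eqP|]; [right|left].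
have LKid := lideal_sum Lid Kid; have JLKid := lideal_capI Jid LKid.
have [|||JLK] := Jmin (J :&: lsum L K); [exact/lidealP|exact: subsetIl| |].
- move=> JLK0; exists (lsum K J); split; first exact: lideal_sum.
    apply/setP=> x; rewrite !inE; apply/andP/eqP=> [[xL]|->].
      move=> xKJ; have : x \in lsum K J by rewrite inE.
      (* As [x = k + j] lies in [L], the element [j = x - k] lies in [L + K] and in [J], hence
         vanishes. *)
      move=> /lsumP[k [j [kK jJ xE]]].
      have jLK : j \in J :&: lsum L K.
        rewrite inE jJ; apply/lsumP; exists x, (- k).
        by split=> //; [rewrite -sub0r KB|rewrite xE addrAC subrr add0r].
      have j0 : j = 0 by apply/set1P; rewrite -JLK0.
      have : x \in L :&: K by rewrite inE xL xE j0 addr0.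
      by rewrite LK0 inE => /eqP.
    split=> //; apply/existsP; exists 0; rewrite K0; apply/existsP; exists 0.
    by rewrite addr0 eqxx; have [-> _ _] := Jid.
  move=> i /caseI[/subK/subsetP Ii|im].
    apply/subsetP=> x /Ii/lsumP[l [k [lL kK ->]]]; apply/lsumP; exists l, k.
    split=> //; apply/lsumP; exists k, 0; rewrite addr0; split=> //.
    by have [] := Jid.
  have -> : i = Ordinal mn by apply: val_inj.
  apply/subsetP=> x xJ; apply/lsumP; exists 0, x; rewrite add0r; split=> //.
  by apply/lsumP; exists 0, x; rewrite add0r.
- exists K; split=> // i /caseI[/subK //|im].
  have -> : i = Ordinal mn by apply: val_inj.
  by rewrite -/J -JLK subsetIr.
Qed.

(** With [K] a complement of [R b] and [1 = y b + k], the element [b k = b - b y b] lies in both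
    [R b] and [K], hence is 0. *)
Lemma semisimple_regular : semisimple_ring R -> regular R.
Proof.
move=> [n [I [Isimple Idec]]] b.
have [K [Kid LK0 subK]] := complement_upto Isimple (lideal_principal b) n.
have [LKid0 LKB _] := lideal_sum (lideal_principal b) Kid.
have [K0 KB KM] := Kid; have [_ LB _] := lideal_principal b.
have : 1 \in lsum [set x * b | x in setT] K.
  have [f [[fI ->] _]] := Idec 1.
  apply: (big_ind (fun x => x \in lsum [set x * b | x in setT] K)) => //.
    by move=> x y xL yL; rewrite -[y]opprK LKB // -sub0r LKB.
  by move=> i _; apply: (subsetP (subK i (ltn_ord i))).
move=> /lsumP[_ [k [/imsetP[y _ ->] kK one]]]; exists y.
have bk : b * k = b - b * y * b.
  by rewrite -{2}[b]mulr1 one mulrDr mulrA addrAC subrr add0r.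
have : b - b * y * b \in [set x * b | x in setT] :&: K.
  rewrite inE -{2}bk KM // andbT LB //; apply/imsetP; first by exists 1; rewrite ?mul1r.
  by exists (b * y).
by rewrite LK0 inE subr_eq0 => /eqP/esym.
Qed.

End Semisimple.

(** * Transfer along an isomorphism of graphs *)

(** The graph isomorphism at the level of elements. It is a relation because classes have no
    distinguished representatives; the last two fields make it one-to-one on classes. *)
Record theta_corr (R S : finPzRingType) (P : R -> S -> Prop) : Prop := ThetaCorr {
  corr_totl : forall x, exists y, P x y;
  corr_totr : forall y, exists x, P x y;
  corr_mul0 : forall x y x' y', P x y -> P x' y' -> (x * x' = 0 <-> y * y' = 0);
  corr_siml : forall x x' y, P x y -> sim x x' <-> P x' y;
  corr_simr : forall x y y', P x y -> sim y y' <-> P x y' }.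

Lemma theta_corr_sym (R S : finPzRingType) (P : R -> S -> Prop) :
  theta_corr P -> theta_corr (fun y x => P x y).
Proof.
move=> [totl totr mul0 siml simr]; split=> //.
- by move=> x y x' y' Pxy Pxy'; split=> /(mul0 _ _ _ _ Pxy Pxy').
- by move=> y y' x; apply: simr.
- by move=> y x x'; apply: siml.
Qed.

Lemma theta_corr_of_iso (R S : finPzRingType) :
  digraph_isomorphic (Theta R) (Theta S) ->
  exists P : R -> S -> Prop, theta_corr P.
Proof.
move=> [f [[g fK gK] fE]].
exists (fun x y => f (sim_class x) = sim_class y); split.
- by move=> x; apply: sim_class_surj.
- by move=> y; have [x gE] := sim_class_surj (g (sim_class y)); exists x; rewrite -gE gK.
- move=> x y x' y' xy xy'; have := fE (sim_class x) (sim_class x').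
  rewrite xy xy' /= !Theta_edgeE => E.
  by split=> /eqP; [rewrite -E|rewrite E] => /eqP.
- move=> x x' y <-; rewrite -sim_class_eq; split=> [/eqP->//|].
  by move=> /(can_inj fK)->.
- by move=> x y y' ->; rewrite -sim_class_eq; split=> [/eqP|->].
Qed.

Section Correspondence.
Variables (R S : finPzRingType) (P : R -> S -> Prop).
Hypothesis PP : theta_corr P.

(** Zero is annihilated by everything, in particular by the counterpart of 1 in the other ring. *)
Lemma corr_eq0 a b : P a b -> a = 0 <-> b = 0.
Proof.
move=> Pab; split=> [a0|b0].
  have [x Px] := corr_totr PP 1; rewrite -[b]mul1r.
  by apply/(corr_mul0 PP Px Pab); rewrite a0 mulr0.
have [y Py] := corr_totl PP 1; rewrite -[a]mul1r.
by apply/(corr_mul0 PP Py Pab); rewrite b0 mulr0.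
Qed.

(** The counterparts of [e] and [1 - e] annihilate each other and have no common right annihilator,
    so [sim_complementary_idem] finds complementary idempotents in their classes. *)
Lemma corr_idem_exists e :
  idem e -> exists g, [/\ idem g, P e g & P (1 - e) (1 - g)].
Proof.
move=> ee; have [b Pb] := corr_totl PP e; have [c Pc] := corr_totl PP (1 - e).
have bc : b * c = 0 by apply/(corr_mul0 PP Pb Pc)/idem_mulC.
have cb : c * b = 0 by apply/(corr_mul0 PP Pc Pb)/idemC_mul.
have [x bx cx|g [gg bg cg]] := sim_complementary_idem bc cb.
  have [w Pw] := corr_totr PP x.
  have ew : e * w = 0 by apply/(corr_mul0 PP Pb Pw).
  have : (1 - e) * w = 0 by apply/(corr_mul0 PP Pc Pw).
  by move=> /mulC_eq0; rewrite ew => /esym/(corr_eq0 Pw).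
by exists g; split=> //; [apply/(corr_simr PP _ Pb)|apply/(corr_simr PP _ Pc)].
Qed.

Lemma corr_idem_inj e e' g : idem e -> idem e' -> P e g -> P e' g -> e = e'.
Proof.
by move=> ee ee' Pe Pe'; apply: sim_idem => //; apply/(corr_siml PP _ Pe).
Qed.

Lemma corr_idemC e g : idem e -> idem g -> P e g -> P (1 - e) (1 - g).
Proof.
move=> ee gg Peg; have [h [hh Peh]] := corr_idem_exists ee.
suff -> : g = h by [].
by apply: sim_idem => //; apply/(corr_simr PP _ Peg).
Qed.

(** The equation [e * a = a] says [(1 - e) * a = 0], which is an edge of the graph. *)
Lemma corr_mull e g a b :
  idem e -> idem g -> P e g -> P a b -> e * a = a <-> g * b = b.
Proof.
move=> ee gg Peg Pab; have PC := corr_mul0 PP (corr_idemC ee gg Peg) Pab.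
by split=> /mulC_eq0/PC/mulC_eq0.
Qed.

Lemma corr_mulr e g a b :
  idem e -> idem g -> P e g -> P a b -> a * e = a <-> b * g = b.
Proof.
move=> ee gg Peg Pab; have PC := corr_mul0 PP Pab (corr_idemC ee gg Peg).
by split=> /mul_eq0C/PC/mul_eq0C.
Qed.

End Correspondence.

(* If b = bcb and c = cbc in S then b, c have the annihilators of the idempotents
   bc and cb. For the counterparts a, d in R and the idempotent e of R
   corresponding to bc this forces ad to be a unit of the corner eRe. *)
Lemma corr_regular (R S : finPzRingType) (P : R -> S -> Prop) :
  theta_corr P -> regular S -> regular R.
Proof.
move=> PP Sreg a; have [b Pab] := corr_totl PP a.
(* Passing from [y] to [y * b * y] adds [c b c = c] to [b c b = b]. *)
have [y byb] := Sreg b; pose c := y * b * y.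
have bcb : b * c * b = b by rewrite /c !mulrA !byb.
have cbc : c * b * c = c.
  have -> : c * b * c = y * (b * y * b) * y * b * y by rewrite /c !mulrA.
  rewrite byb.
  have -> : y * b * y * b * y = y * (b * y * b) * y by rewrite !mulrA.
  by rewrite byb.
have gg : idem (b * c) by rewrite /idem mulrA bcb.
have hh : idem (c * b) by rewrite /idem mulrA cbc.
have [e [ee Pe _]] := corr_idem_exists (theta_corr_sym PP) gg.
have [f [ff Pf _]] := corr_idem_exists (theta_corr_sym PP) hh.
have [d Pd] := corr_totr PP c.
have ea : e * a = a by apply/(corr_mull PP ee gg Pe Pab).
have de : d * e = d by apply/(corr_mulr PP ee gg Pe Pd); rewrite mulrA.
have fd : f * d = d by apply/(corr_mull PP ff hh Pf Pd).
have fann x : a * x = 0 -> f * x = 0.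
  have [z Pz] := corr_totl PP x.
  move=> /(corr_mul0 PP Pab Pz) bz; apply/(corr_mul0 PP Pf Pz).
  by rewrite -mulrA bz mulr0.
have eann x : d * x = 0 -> e * x = 0.
  have [z Pz] := corr_totl PP x.
  move=> /(corr_mul0 PP Pd Pz) cz; apply/(corr_mul0 PP Pe Pz).
  by rewrite -mulrA cz mulr0.
have ead : e * (a * d) = a * d by rewrite mulrA ea.
(* If this element kills [x], multiplying by [e] gives [a d x = 0]; then [d x = f d x = 0], so
   [e x = 0], and what remains is [(1 - e) x = 0]. *)
have [x tx0|w [tw _]] := @lreg_inverse _ (a * d + (1 - e)).
  have adx : a * d * x = 0.
    have : e * ((a * d + (1 - e)) * x) = 0 by rewrite tx0 mulr0.
    by rewrite mulrA mulrDr ead idem_mulC // addr0.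
  have ex : e * x = 0.
    by apply: eann; rewrite -fd -mulrA; apply: fann; rewrite mulrA.
  by move: tx0; rewrite mulrDl adx add0r => /mulC_eq0; rewrite ex.
exists (d * w).
have : e * ((a * d + (1 - e)) * w) = e by rewrite tw mulr1.
rewrite mulrA mulrDr ead idem_mulC // addr0 => adw.
by rewrite mulrA adw.
Qed.

(** * Systems of primitive orthogonal idempotents *)

Record frame (R : pzRingType) (I : finType) (e : I -> R) : Prop := Frame {
  frame_idem : forall i, e i * e i = e i;
  frame_orth : forall i j, i != j -> e i * e j = 0;
  frame_sum : \sum_i e i = 1 }.

Section Orthogonal.
Variable R : finPzRingType.
Implicit Types (E : {set R}) (x y u f : R).

Definition orthogonal E :=
  [forall x in E, [&& x * x == x, x != 0 &
                      [forall y in E, (x != y) ==> (x * y == 0)]]].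

Lemma orthogonalP E :
  reflect [/\ forall x, x \in E -> idem x, forall x, x \in E -> x != 0 &
              forall x y, x \in E -> y \in E -> x != y -> x * y = 0]
          (orthogonal E).
Proof.
apply: (iffP forall_inP) => [ortE|[idE nzE ortE] x xE].
  split=> [x /ortE/and3P[/eqP]|x /ortE/and3P[]|x y] //.
  by move=> /ortE/and3P[_ _ /forall_inP ortx] /ortx/implyP xy /xy/eqP.
rewrite (idE x xE) eqxx nzE //=; apply/forall_inP=> y yE.
by apply/implyP=> xy; rewrite ortE.
Qed.

Lemma orthogonalU1 E u : orthogonal E -> idem u -> u != 0 ->
    (forall y, y \in E -> u * y = 0 /\ y * u = 0) ->
  orthogonal (u |: E) /\ #|u |: E| = #|E|.+1.
Proof.
move=> /orthogonalP[idE nzE ortE] uu u0 uE.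
split; last first.
  rewrite cardsU1; have [/uE[uu0]|//] := boolP (u \in E).
  by move: u0; rewrite -uu uu0 eqxx.
apply/orthogonalP; split=> [x|x|x y]; rewrite !inE.
- by case/orP=> [/eqP->//|]; apply: idE.
- by case/orP=> [/eqP->//|]; apply: nzE.
case/orP=> [/eqP->|xE] /orP[/eqP->|yE]; last exact: ortE.
- by rewrite eqxx.
- by have [] := uE y yE.
- by have [] := uE x xE.
Qed.

Lemma orthogonalD1 E x : orthogonal E -> orthogonal (E :\ x).
Proof.
move=> /orthogonalP[idE nzE ortE]; apply/orthogonalP.
split=> [y|y|y z]; rewrite !inE => /andP[_]; [exact: idE|exact: nzE|].
by move=> yE /andP[_]; apply: ortE.
Qed.

(** Take an orthogonal set of nonzero idempotents of maximal cardinality. A member that is not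
    primitive could be split in two, and if the sum [t] were not 1, then [1 - t] could be added. *)
Lemma primitive_frame_exists :
  exists (I : finType) (e : I -> R), frame e /\ forall i, primitive (e i).
Proof.
have ort0 : orthogonal set0.
  by apply/orthogonalP; split=> [x|x|x y]; rewrite inE.
have [E ortE maxE] := @arg_maxnP _ set0 orthogonal (fun E => #|E|) ort0.
have /orthogonalP[idE nzE orE] := ortE.
have noU u E' : orthogonal E' -> idem u -> u != 0 ->
    (forall y, y \in E' -> u * y = 0 /\ y * u = 0) -> (#|E'| < #|E|)%N.
  move=> oE' uu u0 uE; have [/maxE mE c] := orthogonalU1 oE' uu u0 uE.
  by rewrite -c; exact: mE.
exists {x | x \in E}, val; split; last first.
  move=> [x xE] /=; split; [exact: idE|exact: nzE|] => f ff xf fx.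
  have [->|f0] := eqVneq f 0; first by left.
  have [->|fnx] := eqVneq f x; first by right.
  have fy y : y \in E -> y != x -> f * y = 0 /\ y * f = 0.
    move=> yE yx; split; first by rewrite -fx -mulrA (orE x y) ?mulr0 // eq_sym.
    by rewrite -xf mulrA (orE y x) ?mul0r.
  have xfid : idem (x - f).
    by rewrite /idem mulrBl !mulrBr (idE x xE) xf fx ff subrr subr0.
  have xf0 : x - f != 0 by rewrite subr_eq0 eq_sym.
  (* Replacing [x] by [x - f] keeps the cardinality, yet [f] can still be added. *)
  have [|o1 c1] := orthogonalU1 (orthogonalD1 x ortE) xfid xf0.
    move=> y; rewrite !inE => /andP[yx yE]; have [fy0 yf0] := fy y yE yx.
    by rewrite mulrBl mulrBr fy0 yf0 !subr0 !orE // eq_sym.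
  suff : (#|(x - f)%R |: E :\ x| < #|E|)%N.
    by rewrite c1 (cardsD1 x E) xE add1n ltnn.
  apply: (noU f _ o1 ff f0) => y.
  rewrite !inE => /orP[/eqP->|/andP[yx yE]]; last exact: fy.
  by rewrite mulrBr mulrBl ff fx xf subrr.
split=> [[x xE]|[x xE] [y yE]|] /=; first exact: idE.
  by rewrite -val_eqE /=; apply: orE.
have -> : \sum_(i : {x | x \in E}) val i = \sum_(x in E) x by rewrite (big_sub E).
set t := \sum_(x in E) x.
have xt x : x \in E -> x * t = x.
  move=> xE; rewrite /t (bigD1 x) //= mulrDr (idE x xE) big_distrr /= big1 ?addr0 //.
  by move=> y /andP[yE yx]; rewrite orE // eq_sym.
have tx x : x \in E -> t * x = x.
  move=> xE; rewrite /t (bigD1 x) //= mulrDl (idE x xE) big_distrl /= big1 ?addr0 //.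
  by move=> y /andP[yE yx]; rewrite orE.
have tt : idem t by rewrite /idem {1}/t big_distrl /=; apply: eq_bigr => x /xt.
apply/eqP; rewrite eq_sym -subr_eq0; apply/negPn/negP => u0.
suff : (#|E| < #|E|)%N by rewrite ltnn.
apply: (noU (1 - t) _ ortE (idemC tt) u0) => y yE.
by split; [apply/mulC_eq0/tx|apply/mul_eq0C/xt].
Qed.

End Orthogonal.

Section Frame.
Variables (R : finPzRingType) (I : finType) (e : I -> R).
Hypotheses (Rreg : regular R) (eF : frame e) (eprim : forall i, primitive (e i)).

(** Cut a quasi-inverse [x] of [a] down to [b = e2 x e1]. Then [a b] and [b a] are nonzero
    idempotents of the corners at [e1] and [e2], so primitivity determines them. *)
Lemma primitive_inverse (e1 e2 a : R) : primitive e1 -> primitive e2 ->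
    e1 * a = a -> a * e2 = a -> a != 0 ->
  exists b, [/\ e2 * b = b, b * e1 = b, a * b = e1 & b * a = e2].
Proof.
move=> [ee1 _ min1] [ee2 _ min2] ea ae a0; have [x axa] := Rreg a.
have ab : a * (e2 * x * e1) = a * x * e1 by rewrite !mulrA ae.
have ba : (e2 * x * e1) * a = e2 * x * a by rewrite -!mulrA ea.
exists (e2 * x * e1); split; rewrite ?ab ?ba.
- by rewrite !mulrA ee2.
- by rewrite -!mulrA ee1.
- have [||| axe0|//] := min1 (a * x * e1).
  + by rewrite /idem -mulrA (mulrA e1) (mulrA e1) ea !mulrA axa.
  + by rewrite !mulrA ea.
  + by rewrite -!mulrA ee1.
  + by case/eqP: a0; rewrite -axa -{2}ea mulrA axe0 mul0r.
- have [||| exa0|//] := min2 (e2 * x * a).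
  + by rewrite /idem !mulrA -(mulrA _ a e2) ae -!mulrA (mulrA a) axa.
  + by rewrite !mulrA ee2.
  + by rewrite -!mulrA ae.
  + by case/eqP: a0; rewrite -axa -{1}ae -!mulrA (mulrA e2) exa0 mulr0.
Qed.

(** By [linkedP] this amounts to an isomorphism of the right ideals generated by [e i] and [e j],
    hence is an equivalence relation; its classes are the simple blocks of the ring. *)
Definition linked i j := [exists x, e i * x * e j != 0].

Lemma linkedP i j :
  reflect (exists a b, [/\ e i * a = a, a * e j = a, e j * b = b &
                           [/\ b * e i = b, a * b = e i & b * a = e j]])
          (linked i j).
Proof.
have idm k : e k * e k = e k by have [] := eprim k.
apply: (iffP existsP) => [[x x0]|[a [b [ea ae eb [be ab ba]]]]].
  have [|| b [eb be ab ba]] := primitive_inverse (eprim i) (eprim j) _ _ x0.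
  - by rewrite !mulrA idm.
  - by rewrite -!mulrA idm.
  exists (e i * x * e j), b; split=> //; first by rewrite !mulrA idm.
  by rewrite -!mulrA idm.
exists a; rewrite ea ae; apply/eqP => a0.
by have [_ /eqP[]] := eprim i; rewrite -ab a0 mul0r.
Qed.

Lemma linked_refl i : linked i i.
Proof. by apply/linkedP; exists (e i), (e i); rewrite frame_idem. Qed.

Lemma linked_sym i j : linked i j = linked j i.
Proof.
by apply/idP/idP=> /linkedP[a [b [? ? ? []]]] *; apply/linkedP; exists b, a.
Qed.

Lemma linked_trans j i k : linked i j -> linked j k -> linked i k.
Proof.
move=> /linkedP[a [b [ea ae eb [be ab ba]]]].
move=> /linkedP[c [d [ec ce ed [de cd dc]]]].
apply/linkedP; exists (a * c), (d * b).
split; rewrite ?mulrA ?ea ?ed -?mulrA ?ce ?be //; split=> //.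
  by rewrite (mulrA c) cd eb.
by rewrite (mulrA b) ba ec.
Qed.

Lemma linked_mul0 i j x : ~~ linked i j -> e i * x * e j = 0.
Proof. by rewrite negb_exists => /forallP/(_ x)/negPn/eqP. Qed.

End Frame.

(** * Isomorphisms from matrix units *)

(** Here [r i] represents the block of [i], and within a block the products [p i * q j] are the
    matrix units. The entry of [x] at [i], [j] is [q i * x * p j], an element of the corner at
    [c (r i)]; entries between distinct blocks vanish. *)
Record matrix_units (R : pzRingType) (I : finType) (r : I -> I) (c p q : I -> R) :
    Prop := MatrixUnits {
  mu_qp : forall i, q i * p i = c (r i);
  mu_qp0 : forall i j, i != j -> q i * p j = 0;
  mu_sum : \sum_i p i * q i = 1;
  mu_pc : forall i, p i * c (r i) = p i;
  mu_cq : forall i, c (r i) * q i = q i;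
  mu_off : forall i j x, r i != r j -> q i * x * p j = 0 }.

(** Inserting [1 = \sum_i p i * q i] on both sides of an element recovers it from its entries. *)
Lemma matrix_units_ext (R : pzRingType) (I : finType) (r : I -> I) (c p q : I -> R)
    (U : matrix_units r c p q) (x y : R) :
  (forall i j, r i = r j -> q i * x * p j = q i * y * p j) -> x = y.
Proof.
have E z : z = \sum_i \sum_j p i * (q i * z * p j) * q j.
  rewrite -[LHS]mul1r -[LHS]mulr1 -(mu_sum U) !big_distrl /=.
  apply: eq_bigr => i _; rewrite big_distrr /=.
  by apply: eq_bigr => j _; rewrite !mulrA.
move=> xy; rewrite [x]E [y]E; apply: eq_bigr => i _; apply: eq_bigr => j _.
have [/xy->//|rij] := eqVneq (r i) (r j).
by rewrite !(mu_off U).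
Qed.

Lemma matrix_units_mul (R : pzRingType) (I : finType) (r : I -> I) (c p q : I -> R)
    (U : matrix_units r c p q) i j (x y : R) :
  q i * (x * y) * p j = \sum_k (q i * x * p k) * (q k * y * p j).
Proof.
have -> : x * y = \sum_k x * (p k * q k) * y.
  by rewrite -mulr_suml -mulr_sumr (mu_sum U) mulr1.
by rewrite mulr_sumr mulr_suml; apply: eq_bigr => k _; rewrite !mulrA.
Qed.

(** Encodes a unital multiplicative map from [c R c] to [d S d] by a map on all of [R], so that no
    subtype is involved; multiplicativity is required on the corner only. *)
Record corner_morphism (R S : pzRingType) (c : R) (d : S) (f : R -> S) : Prop :=
    CornerMorphism {
  cm_one : f c = d;
  cm_mul : forall x y, c * x * c = x -> c * y * c = y -> f (x * y) = f x * f y;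
  cm_in : forall x, d * f x * d = f x }.

Section MatrixMap.
Variables (R S : pzRingType) (I : finType) (r : I -> I).
Variables (c p q : I -> R) (d u v : I -> S) (f : I -> {additive R -> S}).
Hypotheses (RU : matrix_units r c p q) (SU : matrix_units r d u v).
Hypothesis fP : forall i, corner_morphism (c (r i)) (d (r i)) (f (r i)).

Definition matrix_map (x : R) : S :=
  \sum_i \sum_(j | r i == r j) u i * f (r i) (q i * x * p j) * v j.

(** The relations between the [v i] and [u k] leave a single term of the double sum, and [cm_in]
    absorbs the remaining factors [d (r i)]. *)
Lemma matrix_map_coord x i j : r i = r j ->
  v i * matrix_map x * u j = f (r i) (q i * x * p j).
Proof.
move=> rij; rewrite /matrix_map (bigD1 i) //= mulrDr mulrDl [in X in _ + X]mulr_sumr.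
rewrite [in X in _ + X]mulr_suml [X in _ + X]big1 /= ?addr0; last first.
  move=> k ki; rewrite mulr_sumr mulr_suml big1 // => l _.
  by rewrite !mulrA (mu_qp0 SU) ?mul0r // eq_sym.
rewrite (bigD1 j) /= ?rij // mulrDr mulrDl [in X in _ + X]mulr_sumr.
rewrite [in X in _ + X]mulr_suml [X in _ + X]big1 /= ?addr0; last first.
  by move=> l /andP[_ lj]; rewrite -!mulrA (mu_qp0 SU) ?mulr0.
by rewrite !mulrA -mulrA !(mu_qp SU) -rij (cm_in (fP i)).
Qed.

Lemma corner_coord x i j : r i = r j ->
  c (r i) * (q i * x * p j) * c (r i) = q i * x * p j.
Proof. by move=> rij; rewrite !mulrA (mu_cq RU) -mulrA rij (mu_pc RU). Qed.

Lemma matrix_map_zmod : zmod_morphism matrix_map.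
Proof.
move=> x y; apply: (matrix_units_ext SU) => i j rij.
rewrite mulrBr mulrBl !matrix_map_coord // mulrBr mulrBl.
by rewrite raddfB.
Qed.

Lemma matrix_map_monoid : monoid_morphism matrix_map.
Proof.
split=> [|x y]; apply: (matrix_units_ext SU) => i j rij.
  rewrite matrix_map_coord // !mulr1; have [<-|ij] := eqVneq i j.
    by rewrite (mu_qp RU) (mu_qp SU) (cm_one (fP i)).
  by rewrite (mu_qp0 RU ij) (mu_qp0 SU ij) raddf0.
rewrite matrix_map_coord // (matrix_units_mul RU) (matrix_units_mul SU) raddf_sum.
apply: eq_bigr => k _ /=.
have [rik|rik] := eqVneq (r i) (r k); last first.
  by rewrite (mu_off RU _ rik) (mu_off SU _ rik) !mul0r raddf0.
have rkj : r k = r j by rewrite -rik.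
rewrite !matrix_map_coord // -rik.
rewrite -(cm_mul (fP i) (x := q i * x * p k) (y := q k * y * p j)) //.
  exact: corner_coord.
by rewrite rik; apply: corner_coord.
Qed.

End MatrixMap.

(** The inverse is the matrix map built from [g]; both compositions are checked entry by entry. *)
Lemma matrix_units_iso (R S : pzRingType) (I : finType) (r : I -> I)
    (c p q : I -> R) (d u v : I -> S)
    (f : I -> {additive R -> S}) (g : I -> {additive S -> R}) :
    matrix_units r c p q -> matrix_units r d u v ->
    (forall i, corner_morphism (c (r i)) (d (r i)) (f (r i))) ->
    (forall i, corner_morphism (d (r i)) (c (r i)) (g (r i))) ->
    (forall i x, c (r i) * x * c (r i) = x -> g (r i) (f (r i) x) = x) ->
    (forall i y, d (r i) * y * d (r i) = y -> f (r i) (g (r i) y) = y) ->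
  ring_isomorphic R S.
Proof.
move=> RU SU fP gP fK gK; pose F := matrix_map r p q u v f.
have zF : zmod_morphism F by apply: matrix_map_zmod SU fP.
have mF : monoid_morphism F by apply: matrix_map_monoid RU SU fP.
pose F1 := GRing.isZmodMorphism.Build R S F zF.
pose F2 := GRing.isMonoidMorphism.Build R S F mF.
exists (HB.pack F F1 F2 : {rmorphism R -> S}).
exists (matrix_map r u v p q g) => [x|y] /=.
  apply: (matrix_units_ext RU) => i j rij.
  rewrite (matrix_map_coord _ _ RU gP) // /F (matrix_map_coord _ _ SU fP) //.
  by rewrite fK // (corner_coord RU).
apply: (matrix_units_ext SU) => i j rij.
rewrite /F (matrix_map_coord _ _ SU fP) // (matrix_map_coord _ _ RU gP) //.
by rewrite gK // (corner_coord SU).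
Qed.

(** * Finite fields of the same cardinality *)

(** Each element of [L] is the value at [w] of some polynomial; send it to the value at [z]. The
    second hypothesis makes this independent of the polynomial. *)
Lemma rmorphism_of_simple_extension (K : comNzRingType) (L M : comNzRingType)
    (i : {rmorphism K -> L}) (j : {rmorphism K -> M}) (w : L) (z : M) :
    (forall x, exists t, x = (map_poly i t).[w]) ->
    (forall t, (map_poly i t).[w] = 0 -> (map_poly j t).[z] = 0) ->
  exists f : {rmorphism L -> M},
    forall t, f (map_poly i t).[w] = (map_poly j t).[z].
Proof.
move=> surj kerP.
have surjb x : exists t, (map_poly i t).[w] == x.
  by have [t ->] := surj x; exists t.
pose t x := xchoose (surjb x).
have tE x : (map_poly i (t x)).[w] = x by apply/eqP/(xchooseP (surjb x)).
pose f x := (map_poly j (t x)).[z].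
have fE s : f (map_poly i s).[w] = (map_poly j s).[z].
  apply/eqP; rewrite -subr_eq0 -hornerN -hornerD -rmorphB; apply/eqP/kerP.
  by rewrite rmorphB hornerD hornerN tE subrr.
have fB : zmod_morphism f.
  move=> x y; rewrite -{1}(tE x) -{1}(tE y) -hornerN -hornerD -rmorphB fE.
  by rewrite rmorphB hornerD hornerN.
have fM : monoid_morphism f.
  split.
    have {1}-> : 1 = (map_poly i 1).[w] by rewrite rmorph1 hornerC.
    by rewrite fE rmorph1 hornerC.
  move=> x y; rewrite -{1}(tE x) -{1}(tE y) -hornerM -rmorphM fE.
  by rewrite rmorphM hornerM.
pose aM := GRing.isZmodMorphism.Build L M f fB.
pose mM := GRing.isMonoidMorphism.Build L M f fM.
pose F : {rmorphism L -> M} := HB.pack f aM mM.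
by exists F => s; apply: fE.
Qed.

Lemma map_polyXnsubX (K L : comNzRingType) (i : {rmorphism K -> L}) n :
  map_poly i ('X^n - 'X) = 'X^n - 'X.
Proof. by rewrite rmorphB rmorphXn /= map_polyX. Qed.

(** Let [w] generate the multiplicative group of [L]. Its minimal polynomial over the prime field
    divides ['X^#|L| - 'X], which splits in [M] because the cardinalities agree; send [w] to a root
    in [M]. *)
Lemma finField_rmorphism (p : nat) (L M : finFieldType)
    (pL : p \in [pchar L]) (pM : p \in [pchar M]) :
  #|L| = #|M| -> exists f : {rmorphism L -> M}, True.
Proof.
move=> cardLM; pose L' := pPrimeCharType pL; pose M' := pPrimeCharType pM.
have [w wP] : exists w : L, forall x, exists t : nat, x != 0 -> x = w ^+ t.
  have L1 : (0 < #|L|.-1)%N by rewrite -subn1 subn_gt0 finNzRing_gt1.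
  have : has (#|L|.-1).-primitive_root (enum (predC1 (0 : L))).
    apply: has_prim_root => //; last by rewrite -cardE cardC1.
      apply/allP=> x; rewrite mem_enum inE => x0; apply/unity_rootP.
      apply: (mulfI x0); rewrite -exprS prednK ?expf_card ?mulr1 //.
      exact: ltnW (finNzRing_gt1 L).
    exact: enum_uniq.
  case/hasP=> w _ wprim; exists w => x; have [->|x0] := eqVneq x 0.
    by exists 0%N.
  have /(prim_rootP wprim)[i ->] : x ^+ #|L|.-1 = 1.
    apply: (mulfI x0); rewrite -exprS prednK ?expf_card ?mulr1 //.
    exact: ltnW (finNzRing_gt1 L).
  by exists i.
pose i' : {rmorphism 'F_p -> L'} := in_alg L'.
pose i : {rmorphism 'F_p -> L} := i'.
pose j' : {rmorphism 'F_p -> M'} := in_alg M'.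
pose j : {rmorphism 'F_p -> M} := j'.
pose m : {poly L'} := minPoly (1%AS : {subfield L'}) (w : L').
have /polyOver1P[q qE] : m \is a polyOver 1%AS := minPolyOver _ _.
have qdvd t : (map_poly i t).[w] = 0 -> q %| t.
  move=> t0; rewrite -(dvdp_map (in_alg L')) -qE.
  apply: minPoly_dvdp; first by apply/polyOver1P; exists t.
  by apply/eqP.
have [z z0] : exists z, root (map_poly j q) z.
  have : map_poly j q %| 'X^#|M| - 'X.
    have -> : 'X^#|M| - 'X = map_poly j ('X^#|M| - 'X).
      by rewrite map_polyXnsubX.
    rewrite dvdp_map; apply: qdvd.
    rewrite map_polyXnsubX hornerD hornerN hornerXn hornerX.
    by rewrite -cardLM expf_card subrr.
  rewrite finField_genPoly => /dvdp_prod_XsubC[k].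
  (* Up to a constant [q] is a product of some of the factors of ['X^#|M| - 'X]; the product is not
     empty, as a minimal polynomial has positive degree. *)
  case: (mask k _) => [|z s qk].
    rewrite big_nil => /eqp_size; rewrite size_map_poly size_poly1 => q1.
    have := size_minPoly (1%AS : {subfield L'}) (w : L').
    rewrite -/m qE size_map_poly q1.
    by move=> /eqP; rewrite eqSS /adjoin_degree.
  by exists z; rewrite (eqp_root qk) big_cons rootM root_XsubC eqxx.
have [||f _] := @rmorphism_of_simple_extension _ L M i j w z; last by exists f.
- move=> x; have [t tE] := wP x; have [->|x0] := eqVneq x 0.
    by exists 0; rewrite rmorph0 horner0.
  by exists 'X^t; rewrite map_polyXn hornerXn tE.
- move=> t /qdvd/dvdpP[s ->]; rewrite rmorphM hornerM.
  by rewrite (eqP z0) mulr0.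
Qed.

Lemma finField_iso (L M : finFieldType) :
  #|L| = #|M| -> exists f : {rmorphism L -> M}, bijective f.
Proof.
move=> cardLM; have [p pr_p pL] := finPcharP L.
have pM : p \in [pchar M].
  apply: (@card_finPcharP _ _ (logn p #|L|)) => //.
  by rewrite -cardLM; have := card_pprimeChar pL.
have [f _] := finField_rmorphism pL pM cardLM.
exists f; apply: inj_card_bij; first exact: fmorph_inj.
by rewrite cardLM.
Qed.

(** * Corner fields *)

(* The corner ring takes a nonzero idempotent bundled with its properties so that its
   ring structure can be inferred from its type. *)
Record nzidem (R : pzRingType) := NzIdem {
  nzidem_val : R;
  nzidemP : nzidem_val * nzidem_val = nzidem_val;
  nzidem_neq0 : nzidem_val != 0 }.

Section Corner.
Variables (R : finPzRingType) (E : nzidem R).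
Local Notation e := (nzidem_val E).

Definition corner : Type := {x : R | e * x * e == x}.
HB.instance Definition _ := Finite.copy corner {x : R | e * x * e == x}.

Lemma corner_of_subproof (x : R) : e * (e * x * e) * e == e * x * e.
Proof. by rewrite !mulrA nzidemP -!mulrA nzidemP. Qed.

Definition corner_of (x : R) : corner :=
  exist (fun x => e * x * e == x) _ (corner_of_subproof x).

Definition corner_val (a : corner) : R := sval a.

Lemma corner_valK a : e * corner_val a * e = corner_val a.
Proof. by case: a => x /= /eqP. Qed.

Lemma corner_val_inj : injective corner_val.
Proof. exact: val_inj. Qed.

Lemma corner_vall a : e * corner_val a = corner_val a.
Proof. by rewrite -corner_valK !mulrA nzidemP. Qed.

Lemma corner_valr a : corner_val a * e = corner_val a.
Proof. by rewrite -corner_valK -!mulrA nzidemP. Qed.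

Let add a b := corner_of (corner_val a + corner_val b).
Let opp a := corner_of (- corner_val a).
Let mul a b := corner_of (corner_val a * corner_val b).

Let addE a b : corner_val (add a b) = corner_val a + corner_val b.
Proof. by rewrite /= mulrDr mulrDl !corner_valK. Qed.
Let oppE a : corner_val (opp a) = - corner_val a.
Proof. by rewrite /= mulrN mulNr corner_valK. Qed.
Let mulE a b : corner_val (mul a b) = corner_val a * corner_val b.
Proof. by rewrite /= mulrA corner_vall -mulrA corner_valr. Qed.
Let zeroE : corner_val (corner_of 0) = 0.
Proof. by rewrite /= mulr0 mul0r. Qed.
Let oneE : corner_val (corner_of e) = e.
Proof. by rewrite /= !nzidemP. Qed.

Let addA : associative add.
Proof. by move=> a b c; apply: corner_val_inj; rewrite !addE addrA. Qed.
Let addC : commutative add.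
Proof. by move=> a b; apply: corner_val_inj; rewrite !addE addrC. Qed.
Let add0 : left_id (corner_of 0) add.
Proof. by move=> a; apply: corner_val_inj; rewrite addE zeroE add0r. Qed.
Let addN : left_inverse (corner_of 0) opp add.
Proof. by move=> a; apply: corner_val_inj; rewrite addE oppE zeroE addNr. Qed.
HB.instance Definition _ := GRing.isZmodule.Build corner addA addC add0 addN.

Let mulA : associative mul.
Proof. by move=> a b c; apply: corner_val_inj; rewrite !mulE mulrA. Qed.
Let mul1 : left_id (corner_of e) mul.
Proof. by move=> a; apply: corner_val_inj; rewrite mulE oneE corner_vall. Qed.
Let mulr1 : right_id (corner_of e) mul.
Proof. by move=> a; apply: corner_val_inj; rewrite mulE oneE corner_valr. Qed.
Let mulDl : left_distributive mul +%R.
Proof.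
move=> a b c; apply: corner_val_inj.
by rewrite mulE [corner_val (a + b)]addE [RHS]addE !mulE mulrDl.
Qed.
Let mulDr : right_distributive mul +%R.
Proof.
move=> a b c; apply: corner_val_inj.
by rewrite mulE [corner_val (b + c)]addE [RHS]addE !mulE mulrDr.
Qed.
Let one_neq0 : corner_of e != 0.
Proof.
apply/eqP => /(congr1 corner_val); rewrite oneE zeroE => /eqP.
by rewrite (negPf (nzidem_neq0 E)).
Qed.
HB.instance Definition _ :=
  GRing.Zmodule_isNzRing.Build corner mulA mul1 mulr1 mulDl mulDr one_neq0.

Let munit (a : corner) := [exists b : corner, (b * a == 1) && (a * b == 1)].
Let minv (a : corner) := odflt a [pick b : corner | (b * a == 1) && (a * b == 1)].
Let mulVx : {in munit, left_inverse 1 minv *%R}.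
Proof.
move=> a /existsP[b ab]; rewrite /minv; case: pickP => [c /andP[/eqP //]|/(_ b)].
by rewrite ab.
Qed.
Let mulxV : {in munit, right_inverse 1 minv *%R}.
Proof.
move=> a /existsP[b ab]; rewrite /minv; case: pickP => [c /andP[_ /eqP //]|/(_ b)].
by rewrite ab.
Qed.
Let munitP (a b : corner) : b * a = 1 /\ a * b = 1 -> munit a.
Proof. by move=> [ba ab]; apply/existsP; exists b; rewrite ba ab eqxx. Qed.
Let minv_out : {in [predC munit], minv =1 id}.
Proof.
move=> a /existsPn a_nunit; rewrite /minv; case: pickP => [c|//].
by rewrite (negPf (a_nunit c)).
Qed.
HB.instance Definition _ :=
  GRing.NzRing_hasMulInverse.Build corner mulVx mulxV munitP minv_out.

Lemma corner_val_is_zmod : zmod_morphism corner_val.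
Proof. by move=> a b; rewrite -oppE -addE. Qed.

Lemma corner_valM a b : corner_val (a * b) = corner_val a * corner_val b.
Proof. exact: mulE. Qed.

Lemma corner_val1 : corner_val 1 = e.
Proof. exact: oneE. Qed.

Lemma corner_of_is_zmod : zmod_morphism corner_of.
Proof.
by move=> x y; apply: corner_val_inj; rewrite corner_val_is_zmod /= mulrBr mulrBl.
Qed.

(** A nonzero [a] has a [c] with [c * a = e], so [b = c * a * b = 0]. *)
Lemma corner_domain : regular R -> primitive e ->
  forall a b : corner, a * b = 0 -> (a == 0) || (b == 0).
Proof.
move=> Rreg eprim a b ab0; have [//|a0 /=] := eqVneq a 0.
have va0 : corner_val a != 0.
  by apply: contra a0 => /eqP a0; apply/eqP/corner_val_inj; rewrite zeroE.
have [c [_ _ _ ca]] :=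
  primitive_inverse Rreg eprim eprim (corner_vall a) (corner_valr a) va0.
apply/eqP/corner_val_inj; rewrite zeroE -corner_vall -ca -mulrA -mulE.
by rewrite [mul a b]ab0 zeroE mulr0.
Qed.

End Corner.

Section CornerField.
Variables (R : finPzRingType) (e : R).
Hypotheses (Rreg : regular R) (eprim : primitive e).

Lemma corner_field :
  exists (F : finFieldType) (i : {additive F -> R}) (j : {additive R -> F}),
  [/\ i 1 = e, {morph i : x y / x * y}, cancel i j & forall x, i (j x) = e * x * e].
Proof.
have [ee e0 _] := eprim; pose E := NzIdem ee e0.
(* Wedderburn's little theorem: the finite domain [e R e] is a field. Below, [i] is its inclusion in
   [R] and [j] the compression of [x] to [e x e]. *)
pose F := FinDomainFieldType (corner_domain (E := E) Rreg eprim).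
pose aV :=
  GRing.isZmodMorphism.Build F R (@corner_val R E) (@corner_val_is_zmod R E).
pose aO :=
  GRing.isZmodMorphism.Build R F (@corner_of R E) (@corner_of_is_zmod R E).
pose i : {additive F -> R} := HB.pack (@corner_val R E : F -> R) aV.
pose j : {additive R -> F} := HB.pack (@corner_of R E : R -> F) aO.
exists F, i, j.
split=> //.
- exact: corner_val1.
- by move=> x y; apply: (@corner_valM R E).
- by move=> x; apply: corner_val_inj; apply: (@corner_valK R E).
Qed.
End CornerField.

Lemma corner_iso (R S : finPzRingType) (e : R) (s : S) :
    regular R -> regular S -> primitive e -> primitive s ->
    #|[set x | e * x * e == x]| = #|[set y | s * y * s == y]| ->
  exists (f : {additive R -> S}) (g : {additive S -> R}),
    [/\ corner_morphism e s f, corner_morphism s e g,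
        forall x, e * x * e = x -> g (f x) = x &
        forall y, s * y * s = y -> f (g y) = y].
Proof.
have card_corner (T : finPzRingType) (c : T) (F : finFieldType)
    (i : {additive F -> T}) (j : {additive T -> F}) :
    cancel i j -> (forall x, i (j x) = c * x * c) ->
    #|[set x | c * x * c == x]| = #|F|.
  move=> ij ji; rewrite -(card_codom (can_inj ij)); apply: eq_card => x.
  rewrite inE; apply/eqP/codomP=> [<-|[y ->]]; first by exists (j x).
  by rewrite -ji ij.
move=> Rreg Sreg eprim sprim.
have [ee _ _] := eprim; have [ss _ _] := sprim.
have [F [i [j [i1 iM ij ji]]]] := corner_field Rreg eprim.
have [G [k [l [k1 kM kl lk]]]] := corner_field Sreg sprim.
rewrite (card_corner _ _ _ _ _ ij ji) (card_corner _ _ _ _ _ kl lk).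
move=> /finField_iso[h [h' hK hK']].
have h'B : zmod_morphism h'.
  by move=> x y; apply: (can_inj hK); rewrite rmorphB !hK'.
pose h'A : {additive G -> F} :=
  HB.pack h' (GRing.isZmodMorphism.Build G F h' h'B).
have h'M : {morph h' : x y / x * y}.
  by move=> x y; apply: (can_inj hK); rewrite rmorphM !hK'.
exists (k \o h \o j : {additive R -> S}).
exists (i \o h'A \o l : {additive S -> R}).
have cornerM (T : finPzRingType) (c x y : T) : idem c ->
    c * x * c = x -> c * y * c = y -> c * (x * y) * c = x * y.
  move=> cc xE yE; rewrite mulrA -mulrA; congr (_ * _).
    by rewrite -xE !mulrA cc.
  by rewrite -yE -!mulrA cc.
split=> [|||y yE /=].
- split=> /= [|x y xE yE|x].
  + by rewrite -i1 ij rmorph1.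
  + rewrite -kM -rmorphM; congr (k (h _)); apply: (can_inj ij).
    by rewrite iM !ji xE yE cornerM.
  + by rewrite -lk kl.
- split=> /= [|x y xE yE|x].
  + by rewrite -k1 kl -(rmorph1 h) hK.
  + rewrite -iM -h'M; congr (i (h' _)); apply: (can_inj kl).
    by rewrite kM !lk xE yE cornerM.
  + by rewrite -ji ij.
- by move=> x xE /=; rewrite kl hK ji.
- by rewrite ij hK' lk.
Qed.

(** * Comparison of the two rings *)

Section FrameTransfer.
Variables (R S : finPzRingType) (P : R -> S -> Prop) (PP : theta_corr P).
Variable (I : finType).

Lemma frame_transfer (e : I -> R) :
    frame e -> (forall i, primitive (e i)) ->
  exists s : I -> S, [/\ frame s, forall i, primitive (s i) & forall i, P (e i) (s i)].
Proof.
move=> eF eprim.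
have [s sP] : exists s : I -> S, forall i, idem (s i) /\ P (e i) (s i).
  apply: (fin_all_exists (P := fun i y => idem y /\ P (e i) y)) => i.
  by have [g [gg Pg _]] := corr_idem_exists PP (frame_idem eF i); exists g.
have ss i : idem (s i) by have [] := sP i.
have Pes i : P (e i) (s i) by have [] := sP i.
have ee i : idem (e i) := frame_idem eF i.
have sO i j : i != j -> s i * s j = 0.
  by move=> /(frame_orth eF)/(corr_mul0 PP (Pes i) (Pes j)).
exists s; split=> //; last first.
  move=> i; have [_ e0 emin] := eprim i; split=> //.
    by apply: contraNneq e0 => /(corr_eq0 PP (Pes i))->.
  move=> f ff sf fs.
  have [g [gg Pg _]] := corr_idem_exists (theta_corr_sym PP) ff.
  have eg : e i * g = g by apply/(corr_mull PP (ee i) (ss i) (Pes i) Pg).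
  have ge : g * e i = g by apply/(corr_mulr PP (ee i) (ss i) (Pes i) Pg).
  have [g0|gE] := emin g gg eg ge; first by left; apply/(corr_eq0 PP Pg).
  right; apply: (corr_idem_inj (theta_corr_sym PP) ff (ss i) Pg).
  by rewrite gE.
split=> //; set t := \sum_i s i.
have st i : s i * t = s i.
  rewrite /t (bigD1 i) //= mulrDr ss mulr_sumr big1 ?addr0 // => j ji.
  by rewrite sO // eq_sym.
have tt : idem t by rewrite /idem {1}/t mulr_suml; apply: eq_bigr => i _.
(* Every [s i] kills [1 - t], so every [e i] kills its counterpart [w]; as the [e i] sum to 1,
   [w = 0]. *)
have [w [ww Pw _]] := corr_idem_exists (theta_corr_sym PP) (idemC tt).
apply/eqP; rewrite eq_sym -subr_eq0; apply/eqP/(corr_eq0 PP Pw).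
rewrite -[w]mul1r -(frame_sum eF) mulr_suml big1 // => i _.
by apply/(corr_mul0 PP (Pes i) Pw)/mul_eq0C.
Qed.

Variables (e : I -> R) (s : I -> S).
Hypotheses (eF : frame e) (sF : frame s) (Pes : forall i, P (e i) (s i)).

Let ee i : idem (e i) := frame_idem eF i.
Let ss i : idem (s i) := frame_idem sF i.

Lemma linked_transfer i j : linked e i j -> linked s i j.
Proof.
move=> /existsP[x x0]; have [b Pb] := corr_totl PP (e i * x * e j).
have sb : s i * b = b.
  by apply/(corr_mull PP (ee i) (ss i) (Pes i) Pb); rewrite !mulrA ee.
have bs : b * s j = b.
  by apply/(corr_mulr PP (ee j) (ss j) (Pes j) Pb); rewrite -!mulrA ee.
apply/existsP; exists b; rewrite sb bs.
by apply: contraNneq x0 => /(corr_eq0 PP Pb)->.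
Qed.
End FrameTransfer.

(* The idempotents g with gR = e_i R that are killed by all e_k with k <> i, j:
   they are the e_i + y with y in e_i R e_j. *)
Definition frame_idems (R : finPzRingType) (I : finType) (e : I -> R) i j :=
  [set g | [&& g * g == g, e i * g == g, g * e i == e i &
               [forall k, (k != i) && (k != j) ==> (g * e k == 0)]]].

Lemma frame_idemsP (R : finPzRingType) (I : finType) (e : I -> R) i j g :
  reflect [/\ g * g = g, e i * g = g, g * e i = e i &
              forall k, k != i -> k != j -> g * e k = 0]
          (g \in frame_idems e i j).
Proof.
rewrite inE; apply: (iffP and4P).
  move=> [/eqP ? /eqP ? /eqP ? /forallP gk].
  by split=> // k ki kj; have := gk k; rewrite ki kj => /eqP.
move=> [-> -> -> gk]; rewrite !eqxx; split=> //; apply/forallP=> k.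
by apply/implyP=> /andP[ki kj]; rewrite gk.
Qed.

(** All conditions defining [frame_idems] pass to counterparts, and distinct idempotents have
    distinct idempotent counterparts. *)
Lemma leq_card_frame_idems (R S : finPzRingType) (P : R -> S -> Prop) (I : finType)
    (e : I -> R) (s : I -> S) i j :
    theta_corr P -> frame e -> frame s -> (forall k, P (e k) (s k)) ->
  (#|frame_idems e i j| <= #|frame_idems s i j|)%N.
Proof.
move=> PP eF sF Pes; have ee := frame_idem eF; have ss := frame_idem sF.
have [f fP] : exists f : R -> S, forall g, idem g -> idem (f g) /\ P g (f g).
  apply: (fin_all_exists (P := fun g h => idem g -> idem h /\ P g h)) => g.
  have [/eqP gg|ngg] := boolP (g * g == g); last first.
    by exists 0 => gg; rewrite gg eqxx in ngg.
  by have [h [hh Ph _]] := corr_idem_exists PP gg; exists h.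
rewrite -(card_in_imset (f := f) (D := frame_idems e i j)).
  apply/subset_leq_card/subsetP => _ /imsetP[g /frame_idemsP[gg eg ge gk] ->].
  have [hh Ph] := fP g gg; apply/frame_idemsP; split=> //.
  - exact/(corr_mull PP (ee i) (ss i) (Pes i) Ph).
  - exact/(corr_mull PP gg hh Ph (Pes i)).
  - by move=> k ki kj; apply/(corr_mul0 PP Ph (Pes k))/gk.
move=> g h /frame_idemsP[gg _ _ _] /frame_idemsP[hh _ _ _] fgh.
have [_ Pg] := fP g gg; have [_ Ph] := fP h hh; rewrite -fgh in Ph.
exact: (corr_idem_inj PP gg hh Pg Ph).
Qed.

(** With [a], [b] linking [e i] and [e j], the bijection sends [x] to [e i + x * a]; its inverse
    sends [g] to [(g - e i) * b]. *)
Lemma card_frame_idems (R : finPzRingType) (I : finType) (e : I -> R) i j :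
    regular R -> frame e -> (forall k, primitive (e k)) -> i != j -> linked e i j ->
  #|frame_idems e i j| = #|[set x | e i * x * e i == x]|.
Proof.
move=> Rreg eF eprim ij /(linkedP Rreg eprim)[a [b [ea ae eb [be ab ba]]]].
have ee := frame_idem eF; have eO := frame_orth eF.
have ji : j != i by rewrite eq_sym.
rewrite -(card_in_imset (f := fun x => e i + x * a)
                        (D := [set x | e i * x * e i == x])).
  apply: eq_card => g; apply/frame_idemsP/imsetP=> [[gg eg ge gk]|[x]].
    have gj : (g - e i) * e j = g - e i.
      rewrite -[RHS]mulr1 -(frame_sum eF) mulr_sumr (bigD1 j) //=.
      rewrite big1 ?addr0 // => k kj.
      have [->|ki] := eqVneq k i; first by rewrite mulrBl ge ee subrr.
      by rewrite mulrBl gk // eO 1?eq_sym ?subrr.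
    exists ((g - e i) * b).
      by rewrite inE -mulrA -mulrA be mulrA mulrBr eg ee.
    by rewrite -mulrA ba gj addrC subrK.
  rewrite inE => /eqP xE ->.
  have ex : e i * x = x by rewrite -xE !mulrA ee.
  have ai : a * e i = 0 by rewrite -ae -mulrA eO ?mulr0.
  split.
  - rewrite mulrDl !mulrDr ee mulrA ex -(mulrA x a (e i)) ai mulr0 add0r.
    by rewrite -(mulrA x a) (mulrA a x) -ex (mulrA a (e i)) ai !mul0r mulr0 addr0.
  - by rewrite mulrDr ee mulrA ex.
  - by rewrite mulrDl ee -mulrA ai mulr0 addr0.
  - move=> k ki kj; rewrite mulrDl eO 1?eq_sym // -mulrA -ae -mulrA.
    by rewrite eO 1?eq_sym // !mulr0 addr0.
move=> x y; rewrite !inE => /eqP xE /eqP yE /addrI xy.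
have xe : x * e i = x by rewrite -xE -!mulrA ee.
have ye : y * e i = y by rewrite -yE -!mulrA ee.
by rewrite -xe -ye -ab !mulrA xy.
Qed.

(** Expanding [1 = \sum_l e l] between [x] and [y], only [l = i] survives in [e i * (x * y) * e i],
    so compression to the corner field is a ring morphism. *)
Lemma isolated_has_field_image (R : finPzRingType) (I : finType) (e : I -> R) i :
    regular R -> frame e -> (forall k, primitive (e k)) ->
    (forall j, j != i -> ~~ linked e i j) -> has_field_image R.
Proof.
move=> Rreg eF eprim iso; have ee := frame_idem eF.
have [F [k [j [k1 kM kj jk]]]] := corner_field Rreg (eprim i).
have jM : monoid_morphism j.
  split=> [|x y]; apply: (can_inj kj); first by rewrite jk k1 mulr1 ee.
  rewrite kM !jk.
  have -> : e i * (x * y) * e i = \sum_l (e i * x * e l) * (e l * y * e i).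
    have -> : x * y = \sum_l x * e l * y.
      by rewrite -mulr_suml -mulr_sumr (frame_sum eF) mulr1.
    rewrite mulr_sumr mulr_suml; apply: eq_bigr => l _.
    by rewrite -[in LHS](ee l) !mulrA.
  rewrite (bigD1 i) //= [X in _ + X]big1 ?addr0 // => l li.
  by rewrite linked_mul0 ?mul0r ?iso.
pose f : {rmorphism R -> F} := HB.pack (j : R -> F)
  (GRing.isZmodMorphism.Build R F j (raddfB j))
  (GRing.isMonoidMorphism.Build R F j jM).
exists F, f => y.
by exists (k y); apply: kj.
Qed.

Lemma linked_representative (R : finPzRingType) (I : finType) (e : I -> R) :
    regular R -> frame e -> (forall k, primitive (e k)) ->
  exists r : I -> I, forall i, linked e i (r i) /\
    forall j, linked e i j -> r i = r j.
Proof.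
move=> Rreg eF eprim; have lrefl := linked_refl Rreg eF eprim.
exists (fun i => odflt i [pick j | linked e i j]) => i; split=> [|j ij].
  by case: pickP => [//|/(_ i)]; rewrite lrefl.
(* Linked indices have the same class, and [pick] depends only on the class. *)
have -> : [pick k | linked e i k] = [pick k | linked e j k].
  apply: eq_pick => k /=; apply/idP/idP; last first.
    exact: (linked_trans Rreg eprim ij).
  by apply: (linked_trans Rreg eprim); rewrite (linked_sym Rreg eprim).
by case: pickP => [//|/(_ j)]; rewrite lrefl.
Qed.

Lemma matrix_units_exist (R : finPzRingType) (I : finType) (e : I -> R) (r : I -> I) :
    regular R -> frame e -> (forall k, primitive (e k)) ->
    (forall i, linked e i (r i)) -> (forall i j, linked e i j -> r i = r j) ->
  exists p q, matrix_units r e p q.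
Proof.
move=> Rreg eF eprim rl rE; have ee := frame_idem eF.
have [pq pqP] : exists pq : I -> R * R, forall i,
    [/\ e i * (pq i).1 = (pq i).1, (pq i).1 * e (r i) = (pq i).1,
        e (r i) * (pq i).2 = (pq i).2 & [/\ (pq i).2 * e i = (pq i).2,
        (pq i).1 * (pq i).2 = e i & (pq i).2 * (pq i).1 = e (r i)]].
  apply: (fin_all_exists (P := fun i (ab : R * R) =>
    [/\ e i * ab.1 = ab.1, ab.1 * e (r i) = ab.1,
        e (r i) * ab.2 = ab.2 & [/\ ab.2 * e i = ab.2,
        ab.1 * ab.2 = e i & ab.2 * ab.1 = e (r i)]])) => i.
  by have /(linkedP Rreg eprim)[a [b ?]] := rl i; exists (a, b).
exists (fun i => (pq i).1), (fun i => (pq i).2); split.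
- by move=> i; have [_ _ _ []] := pqP i.
- move=> i j ij; have [_ _ _ [<- _ _]] := pqP i; have [<- _ _ _] := pqP j.
  by rewrite -mulrA (mulrA (e i)) frame_orth // mul0r mulr0.
- by rewrite -(frame_sum eF); apply: eq_bigr => i _; have [_ _ _ []] := pqP i.
- by move=> i; have [] := pqP i.
- by move=> i; have [] := pqP i.
- move=> i j x rij; have [_ _ _ [<- _ _]] := pqP i; have [<- _ _ _] := pqP j.
  have nij : ~~ linked e i j by apply: contraNN rij => /rE ->.
  have -> : (pq i).2 * e i * x * (e j * (pq j).1) =
            (pq i).2 * (e i * x * e j) * (pq j).1.
    by rewrite !mulrA.
  by rewrite linked_mul0 // mulr0 mul0r.
Qed.

Theorem theorem5p4 (R S : finPzRingType)
    (S_semisimple : semisimple_ring S)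
    (S_no_field_image : ~ has_field_image S)
    (Theta_iso : digraph_isomorphic (Theta R) (Theta S)) :
  ring_isomorphic R S.
Proof.
have [P PP] := theta_corr_of_iso Theta_iso.
have Sreg := semisimple_regular S_semisimple; have Rreg := corr_regular PP Sreg.
have [I [e [eF eprim]]] := primitive_frame_exists R.
have [s [sF sprim Pes]] := frame_transfer PP eF eprim.
have link i j : linked e i j = linked s i j.
  apply/idP/idP; first exact: (linked_transfer PP).
  exact: (linked_transfer (theta_corr_sym PP)).
have [r rP] := linked_representative Rreg eF eprim.
have [|i j /(proj2 (rP i))//|p [q RU]] :=
  matrix_units_exist (r := r) Rreg eF eprim.
  by move=> i; have [] := rP i.
(* The same [r] serves both rings because their links agree. *)
have [||u [v SU]] := matrix_units_exist (r := r) Sreg sF sprim.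
- by move=> i; rewrite -link; have [] := rP i.
- by move=> i j; rewrite -link => /(proj2 (rP i)).
have cardE i : #|[set x | e i * x * e i == x]| = #|[set y | s i * y * s i == y]|.
  (* A linked [j] different from [i] turns the corner into a set of idempotents, which the graph
     counts; without one, [S] would have a field image. *)
  have [j /andP[ij lij]|iso] := pickP [pred j | (i != j) && linked e i j].
    rewrite -(card_frame_idems Rreg eF eprim ij) //.
    rewrite -(card_frame_idems Sreg sF sprim ij) -?link //.
    apply/eqP; rewrite eqn_leq (leq_card_frame_idems _ _ PP) //.
    exact: (leq_card_frame_idems _ _ (theta_corr_sym PP)).
  case: S_no_field_image.
  apply: (isolated_has_field_image Sreg sF sprim (i := i)) => j ji.
  by have := iso j; rewrite /= eq_sym ji link /= => ->.
have [fg fgP] : exists fg : I -> {additive R -> S} * {additive S -> R}, forall i,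
    [/\ corner_morphism (e i) (s i) (fg i).1, corner_morphism (s i) (e i) (fg i).2,
        forall x, e i * x * e i = x -> (fg i).2 ((fg i).1 x) = x &
        forall y, s i * y * s i = y -> (fg i).1 ((fg i).2 y) = y].
  apply: (fin_all_exists (P := fun i (fg : {additive R -> S} * {additive S -> R}) =>
    [/\ corner_morphism (e i) (s i) fg.1, corner_morphism (s i) (e i) fg.2,
        forall x, e i * x * e i = x -> fg.2 (fg.1 x) = x &
        forall y, s i * y * s i = y -> fg.1 (fg.2 y) = y])) => i.
  have [f [g fgP]] := corner_iso Rreg Sreg (eprim i) (sprim i) (cardE i).
  by exists (f, g).
apply: (matrix_units_iso (f := fun i => (fg i).1) (g := fun i => (fg i).2) RU SU) => i.
- by have [] := fgP (r i).
- by have [] := fgP (r i).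
- by have [_ _ fK _] := fgP (r i); apply: fK.
- by have [_ _ _ gK] := fgP (r i); apply: gK.
Qed.
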